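(* Fix $m\in\mathbb N$ and $\mathbf y\in\mathbb R^m$. If the statement $\mathrm{WIDSC}(1,m,\mathbf y)$ holds, then $\mathrm{WIDSC}(n,m,\mathbf y)$ holds for all $n\ge1$.
   Context: $\varphi$ is Euler's totient function, $\mathbb R_+$ the nonnegative reals, $|\cdot|$ the maximum norm, $B(\mathbf 0,r)$ the ball of radius $r$ in it; for nonzero $\mathbf q\in\mathbb Z^n$, $\gcd(\mathbf q)$ is the gcd of its entries. For every $\mathbf q\in\mathbb Z^n$ let $P(\mathbf q)=\mathbf y+\mathbb Z^m$. For $\psi:\mathbb Z^n\to\mathbb R_+$, $W_{n,m}^P(\psi)$ is the set of $\mathbf X\in\mathbb T^{nm}=M_{n\times m}(\mathbb R)/M_{n\times m}(\mathbb Z)$ such that $\mathbf q\mathbf X\in B(\mathbf 0,\psi(\mathbf q))+\mathbf y+\mathbb Z^m$ for infinitely many $\mathbf q\in\mathbb Z^n$ ($\mathbf q$ a row vector). We say $\mathrm{WIDSC}(n,m,\mathbf y)$ holds if for every $\psi:\mathbb Z^n\to\mathbb R_+$ with $\sum_{\mathbf q\in\mathbb Z^n\setminus\{\mathbf 0\}}\big(\varphi(\gcd(\mathbf q))\psi(\mathbf q)/\gcd(\mathbf q)\big)^m=\infty$ one has $\mathrm{Leb}(W_{n,m}^P(\psi))=1$. *)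

(* Defs.v *)
From HB Require Import structures.
From mathcomp Require Import all_boot all_order all_algebra generic_quotient.
From mathcomp Require Import all_classical all_reals all_analysis.
Set Implicit Arguments.
Unset Strict Implicit.
Unset Printing Implicit Defensive.
Import Order.TTheory GRing.Theory Num.Theory.
Import numFieldNormedType.Exports.
Local Open Scope classical_set_scope.
Local Open Scope ring_scope.
Local Open Scope quotient_scope.

(* Lebesgue measure on R^k, as an iterated product of the one-dimensional
   measure on Borel sets. Like every library measure, it is a total function on
   sets that is meaningful on measurable sets only; all the limsup sets it is
   applied to below are Borel. *)
Fixpoint lebesgue_tuple (R : realType) (k : nat) :
    set (k.-tuple (measurableTypeR R)) -> \bar R :=
  match k with
  | 0 => \d_([tuple] : 0.-tuple (measurableTypeR R))
  | k'.+1 => pushforward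
      ((@lebesgue_measure R) \x (@lebesgue_tuple R k'))%E
      (fun p : measurableTypeR R * k'.-tuple (measurableTypeR R) =>
         [the k'.+1.-tuple (measurableTypeR R) of p.1 :: p.2])
  end.

Definition mx_of_tuple (R : realType) (n m : nat) (t : (n * m).-tuple R) :
    'M[R]_(n, m) :=
  vec_mx (\row_i tnth t i).

Definition lebesgue_mx (R : realType) (n m : nat) (A : set 'M[R]_(n, m)) :
    \bar R :=
  lebesgue_tuple (@mx_of_tuple R n m @^-1` A).

Definition torus_eqv (R : realType) (n m : nat) (X Y : 'M[R]_(n, m)) : bool :=
  `[< exists Z : 'M[int]_(n, m), X - Y = map_mx intr Z >].

Lemma torus_eqv_equiv (R : realType) (n m : nat) :
  equiv_class_of (@torus_eqv R n m).
Proof.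
split.
- by move=> X; apply/asboolP; exists 0; rewrite subrr map_mx0.
- move=> X Y; apply/asboolP/asboolP => -[Z XYZ]; exists (- Z);
    by rewrite map_mxN -XYZ opprB.
- move=> Y X Z /asboolP[U XY] /asboolP[V YZ]; apply/asboolP; exists (U + V).
  by rewrite map_mxD -XY -YZ addrA subrK.
Qed.

Canonical torus_equiv (R : realType) (n m : nat) : equiv_rel 'M[R]_(n, m) :=
  EquivRelPack (@torus_eqv_equiv R n m).

Definition torus (R : realType) (n m : nat) := {eq_quot (@torus_equiv R n m)}.

Definition unit_cube (R : realType) (n m : nat) : set 'M[R]_(n, m) :=
  [set X | forall i j, 0 <= X i j < 1].

(* The unit cube [0, 1)^(nm) is a fundamental domain of the torus. *)
Definition leb_torus (R : realType) (n m : nat) (A : set (torus R n m)) :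
    \bar R :=
  lebesgue_mx (@unit_cube R n m `&` [set X | A (\pi_(torus R n m) X)]).

Definition gcd_row (n : nat) (q : 'rV[int]_n) : nat :=
  \big[gcdn/0%N]_(i < n) `|q ord0 i|%N.

Definition Pset (R : realType) (m : nat) (y : 'rV[R]_m) : set 'rV[R]_m :=
  [set y + map_mx intr p | p in [set: 'rV[int]_m]].

(* [ball] on matrices is the open ball of the maximum norm. *)
Definition Wset (R : realType) (n m : nat) (y : 'rV[R]_m)
    (psi : 'rV[int]_n -> R) : set (torus R n m) :=
  [set \pi_(torus R n m) X | X in
     [set X : 'M[R]_(n, m) | infinite_set
        [set q : 'rV[int]_n |
           [set b + p | b in ball (0 : 'rV[R]_m) (psi q) & p in Pset y]
             (map_mx intr q *m X)]]].

Definition WIDSC (R : realType) (n m : nat) (y : 'rV[R]_m) : Prop :=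
  forall psi : 'rV[int]_n -> R,
    (forall q, 0 <= psi q) ->
    \esum_(q in [set q : 'rV[int]_n | q != 0])
      ((((totient (gcd_row q))%:R * psi q / (gcd_row q)%:R) ^+ m)%:E)
      = +oo%E ->
    leb_torus (Wset y psi) = 1%E.

(* Main.v *)
(** Write a nonzero q in Z^n as q = d p with p primitive and d = +-gcd(q), so
    that qX = d(pX).  For nonzero p the point pX is uniformly distributed on the
    torus T^m, and for nonparallel p, p' the points pX and p'X are independent.
    If the divergence already takes place along one line Zp, WIDSC(1) applies to
    the point pX.  Otherwise let V_p be the set of z such that dz is within
    psi(dp) of y + Z^m for some d <> 0.  If the measures of the V_p have
    infinite sum, the Borel-Cantelli lemma for pairwise independent events shows
    that almost every X has pX in V_p for infinitely many p.  If their sum were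
    finite, dilating finite parts of the functions d |-> psi(dp) by distinct
    large primes N_p would make their supports disjoint while neither increasing
    the measures of the V_p nor decreasing the weighted sums by more than a
    constant factor; gluing the pieces into one function on Z would contradict
    WIDSC(1). *)
From HB Require Import structures.
Require Import Defs.
From mathcomp Require Import all_boot all_order all_algebra.
From mathcomp Require Import all_classical all_reals all_analysis.
From mathcomp Require Import generic_quotient measurable_realfun.
From mathcomp Require Import lra ring zify.

Set Implicit Arguments.
Unset Strict Implicit.
Unset Printing Implicit Defensive.
Import Order.TTheory GRing.Theory Num.Theory.
Import numFieldNormedType.Exports.
Local Open Scope classical_set_scope.
Local Open Scope ring_scope.

(** * The uniform measure on the unit cube *)

Section unit_interval.
Variable R : realType.
Local Notation RR := (measurableTypeR R).
Local Notation leb := (@lebesgue_measure R).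

(** Kept as a measure on the whole line, so that periodic sets can be translated without reduction
    modulo 1. *)
Definition unit_prob : set RR -> \bar R :=
  mrestr leb (measurable_itv `[0, 1[ : @measurable _ RR `[0, 1[%classic).

HB.instance Definition _ := Measure.on unit_prob.

Let unit_prob_setT : unit_prob [set: RR] = 1%E.
Proof.
rewrite /unit_prob /mrestr setTI lebesgue_measure_itv/= lte_fin ltr01.
by rewrite oppr0 adde0.
Qed.

HB.instance Definition _ := Measure_isProbability.Build _ _ _
  unit_prob unit_prob_setT.

Lemma lebesgue_measure_shift (c : R) (A : set RR) : measurable A ->
  leb [set x | A (x + c)] = leb A.
Proof.
move=> mA.
have mf : measurable_fun [set: RR] (fun x : RR => x + c : RR).
  exact: measurable_funD.
pose f : {mfun RR >-> RR} := HB.pack (fun x : RR => x + c : RR)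
  (isMeasurableFun.Build _ _ _ _ _ mf).
apply/esym/(@lebesgue_measure_unique R (pushforward leb f)) =>
  //= _ [[a b]] _ <-.
rewrite /pushforward.
have -> : f @^-1` `]a, b] = `]a - c, b - c]%classic.
  by apply/seteqP; split => x/=; rewrite /f/= !in_itv/= ltrBlDr lerBrDr.
rewrite !lebesgue_measure_itv/= !lte_fin ltrD2r; case: ifP => // _.
by rewrite -!EFinB; congr EFin; ring.
Qed.

(** The translated window [c, 1 + c[ splits at 1; periodicity moves the piece [1, 1 + c[ back onto
    [0, c[. *)
Lemma unit_prob_shift01 (c : R) (A : set RR) : measurable A ->
  (forall x, A (x + 1) <-> A x) -> 0 <= c -> c <= 1 ->
  unit_prob [set x | A (x + c)] = unit_prob A.
Proof.
move=> mA A1 c0 c1; rewrite /unit_prob /mrestr.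
have -> : [set x | A (x + c)] `&` `[0, 1[ =
    [set x | (A `&` `[c, 1 + c[) (x + c)].
  by apply/seteqP; split => x/=; rewrite !in_itv/= lerDr ltrD2r.
rewrite lebesgue_measure_shift; last exact: measurableI.
have -> : A `&` `[c, 1 + c[ = (A `&` `[c, 1[) `|` (A `&` `[1, 1 + c[).
  rewrite -setIUr; congr (_ `&` _); apply/seteqP; split => x/=;
    rewrite !in_itv/=.
    by move=> /andP[-> ->]/=; case: (ltP x 1) => _; [left|right].
  by move=> [/andP[-> ?]|/andP[? ->]]; apply/andP; split => //; lra.
rewrite measureU; [|exact: measurableI|exact: measurableI|]; last first.
  by apply/seteqP; split => // x [[_ +] [_ +]]; rewrite /= !in_itv/=; lra.
have -> : A `&` `[0, 1[ = (A `&` `[c, 1[) `|` (A `&` `[0, c[).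
  rewrite -setIUr; congr (_ `&` _); apply/seteqP; split => x/=;
    rewrite !in_itv/=.
    by move=> /andP[-> ->]/=; rewrite andbT; case: (ltP x c) => _; [right|left].
  by move=> [/andP[? ->]|/andP[-> ?]]; lra.
rewrite measureU; [|exact: measurableI|exact: measurableI|]; last first.
  by apply/seteqP; split => // x [[_ +] [_ +]]; rewrite /= !in_itv/=; lra.
congr (_ + _)%E.
transitivity (leb [set x | (A `&` `[1, 1 + c[) (x + 1)]).
  by rewrite lebesgue_measure_shift//; exact: measurableI.
congr (leb _); apply/seteqP; split => x/=; rewrite !in_itv/=.
  by move=> [/A1 ?] ?; split => //; lra.
by move=> [/A1 ?] ?; split => //; lra.
Qed.

Lemma periodic_int (A : set RR) : (forall x, A (x + 1) <-> A x) ->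
  forall (z : int) x, A (x + z%:~R) <-> A x.
Proof.
move=> A1; have An (n : nat) x : A (x + n%:R) <-> A x.
  elim: n x => [|n IH] x; first by rewrite addr0.
  by rewrite -natr1 addrA A1.
move=> [n|n] x; first exact: An.
by rewrite NegzE mulrNz -[in X in _ <-> X](subrK (n.+1%:R) x) An.
Qed.

Lemma unit_prob_shift (c : R) (A : set RR) : measurable A ->
  (forall x, A (x + 1) <-> A x) ->
  unit_prob [set x | A (x + c)] = unit_prob A.
Proof.
move=> mA A1; have Az := periodic_int A1.
rewrite -(@unit_prob_shift01 (c - (Num.floor c)%:~R) A)//.
- congr unit_prob; apply/seteqP; split => x /=.
    by move=> Ax; apply/(Az (Num.floor c)); rewrite -addrA subrK.
  by move=> /(Az (Num.floor c)); rewrite -addrA subrK.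
- by rewrite subr_ge0 ge_floor.
- by rewrite lerBlDr addrC ltW// -intrD1 floorD1_gt.
Qed.

End unit_interval.

Section cube.
Variable R : realType.
Local Notation RR := (measurableTypeR R).

Definition tcons k (p : RR * k.-tuple RR) : k.+1.-tuple RR :=
  [the k.+1.-tuple RR of p.1 :: p.2].

Lemma measurable_tcons k : measurable_fun [set: _] (@tcons k).
Proof. exact: measurable_cons. Qed.

HB.instance Definition _ k :=
  isMeasurableFun.Build _ _ _ _ (@tcons k) (@measurable_tcons k).

(** The recursion mirrors [lebesgue_tuple], with [unit_prob] as factor, so that the two can be
    compared by induction. *)
Fixpoint cube_prob (k : nat) : probability (k.-tuple RR) R :=
  match k with
  | 0 => [the probability _ R of \d_([tuple] : 0.-tuple RR)]
  | k'.+1 => [the probability _ R of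
      distribution [the probability _ R of (@unit_prob R \x cube_prob k')%E]
        (@tcons k')]
  end.

Lemma cube_probS k (A : set (k.+1.-tuple RR)) :
  cube_prob k.+1 A = (\int[@unit_prob R]_x cube_prob k [set t | A (tcons (x,
    t))])%E.
Proof.
rewrite /= /distribution/= /pushforward /product_measure1; apply: eq_integral.
move=> x _ /=; congr (cube_prob k _); apply/seteqP; split=> t /=.
  by rewrite /xsection/= inE.
by rewrite /xsection/= inE.
Qed.

End cube.

Section cube_theory.
Variable R : realType.
Local Notation RR := (measurableTypeR R).
Local Notation leb := (@lebesgue_measure R).

(** By periodicity g(x + c) is g at the fractional part of x + c, and taking that fractional part
    preserves [unit_prob]; the rest is a change of variables. *)
Lemma integral_unit_prob_shift (g : RR -> \bar R) (c : R) :
  measurable_fun [set: RR] g -> (forall x, (0 <= g x)%E) ->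
  (forall x, g (x + 1) = g x) ->
  (\int[@unit_prob R]_x g (x + c)%R = \int[@unit_prob R]_x g x)%E.
Proof.
move=> mg g0 g1.
have gz (z : int) x : g (x + z%:~R) = g x.
  have := @periodic_int R (fun u => g u = g x) _ z x.
  by move=> H; apply/H => // u; rewrite g1.
pose f (x : RR) : RR := x + c - (Num.floor (x + c))%:~R.
have mshift : measurable_fun [set: RR] (fun x : RR => x + c : RR).
  exact: measurable_funD.
have mfloor : measurable_fun [set: RR] (fun x : RR =>
  (Num.floor (x + c))%:~R : RR).
  apply: nondecreasing_measurable => // x x' xx'.
  by rewrite ler_int le_floor// lerD2r.
have mf : measurable_fun [set: RR] f by exact: measurable_funB.
transitivity (\int[@unit_prob R]_x (g \o f) x)%E.
  by apply: eq_integral => x _ /=; rewrite /f -mulrNz gz.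
rewrite -[X in integral _ X _](preimage_setT f).
rewrite -ge0_integral_pushforward//.
apply: eq_measure_integral => //= B mB _.
rewrite /pushforward.
(* The periodic extension of the part of B in [0, 1[: the preimage of B under f is a translate of
   it. *)
pose B' := [set x : RR | B (x - (Num.floor x)%:~R)].
have mB' : measurable B'.
  have mh : measurable_fun [set: RR] (fun x : RR => x - (Num.floor x)%:~R : RR).
    apply: measurable_funB => //;
      apply: nondecreasing_measurable => // x x' xx'.
    by rewrite ler_int le_floor.
  by have := mh measurableT _ mB; rewrite setTI.
rewrite -[LHS]/(unit_prob [set x | B' (x + c)]) unit_prob_shift//.
- rewrite /unit_prob /mrestr; congr (leb _).
  have fl (x : R) : 0 <= x < 1 -> x - (Num.floor x)%:~R = x.
    by move=> x01; rewrite (@floor_def _ x 0) ?subr0.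
  apply/seteqP; split => x/=; rewrite in_itv/= => -[Bx x01]; split => //.
    by move: Bx; rewrite /B'/= fl.
  by rewrite /B'/= fl.
- by move=> x; rewrite /B'/= floorDrz// floor1 intrD opprD addrACA subrr addr0.
Qed.

Definition tadd k (t v : k.-tuple RR) : k.-tuple RR :=
  [tuple tnth t i + tnth v i | i < k].

Definition tperiodic k (A : set (k.-tuple RR)) :=
  forall z t : k.-tuple RR, (forall i, tnth z i \is a Num.int) ->
    A (tadd t z) <-> A t.

Lemma tadd_tcons k x (t v : k.-tuple RR) c :
  tadd (tcons (x, t)) (tcons (c, v)) = tcons (x + c, tadd t v).
Proof.
apply: eq_from_tnth => i; rewrite tnth_mktuple.
case: (unliftP ord0 i) => [j ->|->]; last by rewrite /tcons/= !tnth0.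
by rewrite /tcons/= !tnthS tnth_mktuple.
Qed.

Lemma tcons_surj k (v : k.+1.-tuple RR) : v
  = tcons (thead v, [tuple of behead v]).
Proof. by rewrite [LHS]tuple_eta; apply: val_inj. Qed.

Lemma measurable_tcons_section k (A : set (k.+1.-tuple RR)) x :
  measurable A -> measurable [set t | A (tcons (x, t))].
Proof.
move=> mA; have mT : measurable (@tcons R k @^-1` A).
  by rewrite -[X in measurable X]setTI; exact: measurable_tcons.
rewrite (_ : [set _ | _] = xsection (@tcons R k @^-1` A) x).
  exact: measurable_xsection.
by apply/seteqP; split => t; rewrite /xsection/= inE.
Qed.

Lemma measurable_cube_prob_section k (A : set (k.+1.-tuple RR)) :
  measurable A ->
  measurable_fun [set: RR] (fun x => cube_prob R k [set t | A (tcons (x, t))]).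
Proof.
move=> mA; have mT : measurable (@tcons R k @^-1` A).
  by rewrite -[X in measurable X]setTI; exact: measurable_tcons.
have := measurable_fun_xsection (cube_prob R k) mT.
apply: eq_measurable_fun => x _ /=; congr (cube_prob R k _).
by apply/seteqP; split => t; rewrite /xsection/= inE.
Qed.

(** Induction on k by slicing: in each slice the shift of the tail disappears by the induction
    hypothesis, and the shift of the head acts on a periodic function of one variable. *)
Lemma cube_prob_shift k (A : set (k.-tuple RR)) (v : k.-tuple RR) :
  measurable A -> tperiodic A ->
  cube_prob R k [set t | A (tadd t v)] = cube_prob R k A.
Proof.
elim: k A v => [|k IH] A v mA pA.
  by congr (cube_prob R 0 _); apply/funext => t /=;
    rewrite (tuple0 (tadd _ _)) (tuple0 t).
rewrite !cube_probS (tcons_surj v).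
set c := thead v; set v' := [tuple of behead v].
pose g x := cube_prob R k [set t | A (tcons (x, t))].
transitivity (\int[@unit_prob R]_x g (x + c)%R)%E.
  apply: eq_integral => x _; rewrite /g.
  rewrite -(IH [set t | A (tcons (x + c, t))] v').
  - by congr (cube_prob R k _); apply/funext => t /=; rewrite tadd_tcons.
  - exact: measurable_tcons_section.
  - move=> z t zi /=.
    have -> : tcons (x + c, tadd t z) = tadd (tcons (x + c, t)) (tcons (0, z)).
      by rewrite tadd_tcons addr0.
    apply: pA => i; case: (unliftP ord0 i) => [j ->|->].
      by rewrite /tcons/= tnthS.
    by rewrite /tcons/= tnth0 rpred0.
apply: integral_unit_prob_shift => //;
  first exact: measurable_cube_prob_section.
move=> x; congr (cube_prob R k _); apply/funext => t /=; apply/propext.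
have -> : tcons (x + 1, t)
  = tadd (tcons (x, t)) (tcons (1, [tuple (0 : RR) | i < k])).
  rewrite tadd_tcons; congr (tcons (_, _)); apply: eq_from_tnth => i.
  by rewrite !tnth_mktuple addr0.
apply: pA => i; case: (unliftP ord0 i) => [j ->|->].
  by rewrite /tcons/= tnthS tnth_mktuple rpred0.
by rewrite /tcons/= tnth0 rpred1.
Qed.

Lemma lebesgue_tuple0 k : @lebesgue_tuple R k set0 = 0%E.
Proof.
elim: k => [|k IH]; first by rewrite /= measure0.
rewrite /= /pushforward preimage_set0 /product_measure1 integral0_eq// =>
  x _ /=.
by rewrite xsection0.
Qed.

(** Slices of the cube at x outside [0, 1[ are empty, and on [0, 1[ Lebesgue measure and [unit_prob]
    agree. *)
Lemma lebesgue_tuple_cube k (A : set (k.-tuple RR)) : measurable A ->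
  lebesgue_tuple ([set t | forall i, 0
    <= tnth t i < 1] `&` A) = cube_prob R k A.
Proof.
elim: k A => [|k IH] A mA.
  congr (\d_ _ _); apply/seteqP; split => [t []//|t At]; split => // -[] //.
rewrite cube_probS /= /pushforward /product_measure1.
transitivity (\int[leb]_x (((fun x => cube_prob R k [set t | A (tcons (x, t))])
    \_ `[0%R, 1%R[) x))%E.
  apply: eq_integral => x _ /=; rewrite patchE; case: ifPn => x01.
    rewrite -IH; last exact: measurable_tcons_section.
    congr (lebesgue_tuple _); apply/funext => t; apply/propext.
    rewrite /xsection/= inE/= ; split=> -[c At]; split=> //.
      by move=> i; have := c (lift ord0 i); rewrite tnthS.
    move=> i; case: (unliftP ord0 i) => [j ->|->]; first by rewrite tnthS.
    by rewrite tnth0; move: x01; rewrite inE/= in_itv.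
  rewrite -[RHS](lebesgue_tuple0 k); congr (lebesgue_tuple _).
  apply/seteqP; split => // t; rewrite /xsection/= inE/= => -[c At].
  have := c ord0; rewrite tnth0/= => x01'.
  by move/negP: x01; apply; rewrite inE/= in_itv.
rewrite -integral_mkcond.
pose I : set RR := `[0, 1[%classic.
have mI : measurable I by exact: measurable_itv.
rewrite [RHS](@ge0_negligible_integral _ _ _ _ setT (~` I))//.
- rewrite setTD setCK; apply: eq_measure_integral => B mB BI.
  by rewrite /= /unit_prob /mrestr; congr (leb _); exact/esym/setIidl.
- exact: measurableC.
- exact: measurable_cube_prob_section.
- by rewrite /= /unit_prob /mrestr setICl measure0.
Qed.

End cube_theory.

(** * Integer rows acting on random matrices *)

Section matrix_probability.
Variable R : realType.
Local Notation RR := (measurableTypeR R).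

Definition tuple_of_mx n m (X : 'M[R]_(n, m)) : (n * m).-tuple RR :=
  [tuple mxvec X ord0 i | i < n * m].

Lemma tuple_of_mxK n m : cancel (@tuple_of_mx n m) (@mx_of_tuple R n m).
Proof.
move=> X; rewrite /mx_of_tuple -[RHS]mxvecK; congr vec_mx.
by apply/rowP => i; rewrite mxE tnth_mktuple.
Qed.

Lemma mx_of_tupleE n m (t : (n * m).-tuple RR) i j :
  mx_of_tuple t i j = tnth t (mxvec_index i j).
Proof. by rewrite /mx_of_tuple mxE mxE. Qed.

Lemma mx_of_tuple_tadd n m (t v : (n * m).-tuple RR) :
  mx_of_tuple (tadd t v) = mx_of_tuple t + mx_of_tuple v.
Proof. by apply/matrixP => i j;
  rewrite mx_of_tupleE tnth_mktuple [RHS]mxE !mx_of_tupleE. Qed.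

Definition mxmeasurable n m (S : set 'M[R]_(n, m)) :=
  measurable (@mx_of_tuple R n m @^-1` S : set ((n * m).-tuple RR)).

(** The law of a matrix with independent entries uniform on [0, 1[; on periodic sets it is the Haar
    measure of the torus. *)
Definition mxprob n m (S : set 'M[R]_(n, m)) : \bar R :=
  cube_prob R (n * m) (@mx_of_tuple R n m @^-1` S).

(** These are the preimages of subsets of the torus. *)
Definition mxperiodic n m (S : set 'M[R]_(n, m)) :=
  forall (Z : 'M[int]_(n, m)) X, S (X + map_mx intr Z) <-> S X.

Lemma lebesgue_mx_cube n m (S : set 'M[R]_(n, m)) : mxmeasurable S ->
  lebesgue_mx (@unit_cube R n m `&` S) = mxprob S.
Proof.
move=> mS; rewrite /mxprob -lebesgue_tuple_cube//.
rewrite /lebesgue_mx; congr lebesgue_tuple; rewrite preimage_setI; congr setI.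
apply/seteqP; split => t /=.
  by move=> H i; case/mxvec_indexP: i => i j; rewrite -mx_of_tupleE; exact: H.
by move=> H i j; rewrite mx_of_tupleE.
Qed.

Lemma mxprob_shift n m (S : set 'M[R]_(n, m)) V : mxmeasurable S ->
  mxperiodic S -> mxprob [set X | S (X + V)] = mxprob S.
Proof.
move=> mS pS; rewrite /mxprob -[RHS](@cube_prob_shift _ _ _ (tuple_of_mx V))//.
  by congr (cube_prob R _ _); apply/funext => t/=;
    rewrite mx_of_tuple_tadd tuple_of_mxK.
move=> z t zi /=; rewrite mx_of_tuple_tadd.
pose Z := \matrix_(i, j) Num.floor (mx_of_tuple z i j) : 'M[int]_(n, m).
rewrite (_ : mx_of_tuple z = map_mx intr Z)//.
by apply/matrixP => i j; rewrite !mxE floorK// mx_of_tupleE zi.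
Qed.

Lemma measurable_mx_entry n m i j :
  measurable_fun [set: (n * m).-tuple RR] (fun t => mx_of_tuple t i j : RR).
Proof.
rewrite (_ : (fun t => _) = (@tnth _ RR ^~ (mxvec_index i j))).
  exact: measurable_tnth.
by apply/funext => t; rewrite mx_of_tupleE.
Qed.

Lemma measurable_to_mx d (T : measurableType d) n m (f : T -> 'M[R]_(n, m)) :
  (forall i j, measurable_fun [set: T] (fun x => f x i j : RR)) ->
  forall S, mxmeasurable S -> measurable (f @^-1` S).
Proof.
move=> mf S mS.
have mg : measurable_fun [set: T] (fun x => tuple_of_mx (f x)).
  apply/measurable_fun_tnthP => k; case/mxvec_indexP: k => i j.
  have := mf i j; apply: eq_measurable_fun => x _ /=.
  by rewrite tnth_mktuple mxvecE.
have := mg measurableT _ mS; rewrite setTI.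
by rewrite -comp_preimage (_ : _ \o _ = f)//; apply/funext => x /=;
  rewrite tuple_of_mxK.
Qed.

Lemma measurable_mulmx_entry d (T : measurableType d) n m (q : 'rV[R]_n)
    (f : T -> 'M[R]_(n, m)) :
  (forall i j, measurable_fun [set: T] (fun x => f x i j : RR)) ->
  forall i j, measurable_fun [set: T] (fun x => (q *m f x) i j : RR).
Proof.
move=> mf i j.
rewrite (_ : (fun x => _) = (fun x => \sum_k q i k * f x k j : RR)); last first.
  by apply/funext => x; rewrite mxE.
apply: (@measurable_sum _ T R) => k.
apply: (@measurable_funM _ T R) => //; exact: mf.
Qed.

Definition act n m (q : 'rV[int]_n) (X : 'M[R]_(n, m)) : 'rV[R]_m :=
  map_mx intr q *m X.

Lemma mxmeasurable_act n m (q : 'rV[int]_n) (E : set 'rV[R]_m) :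
  mxmeasurable E -> mxmeasurable [set X : 'M[R]_(n, m) | E (act q X)].
Proof.
move=> mE; rewrite /mxmeasurable.
apply: (@measurable_to_mx _ _ _ _ (fun t => act q (mx_of_tuple t))) => //.
by apply: measurable_mulmx_entry => i j; exact: measurable_mx_entry.
Qed.

Lemma mxperiodic_act n m (q : 'rV[int]_n) (E : set 'rV[R]_m) :
  mxperiodic E -> mxperiodic [set X : 'M[R]_(n, m) | E (act q X)].
Proof. by move=> pE Z X /=; rewrite /act mulmxDr -map_mxM pE. Qed.

(* Shifting [X] by [V] with [q V = W] turns [E (q X)] into [E (q X + W)] without
   changing [G X]; averaging over [W] in the unit cube decouples the two
   conditions. *)
Lemma mxprob_act_indep n m (q : 'rV[int]_n) (G : set 'M[R]_(n, m))
    (E : set 'rV[R]_m) :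
  mxmeasurable G -> mxperiodic G -> mxmeasurable E -> mxperiodic E ->
  (forall W : 'rV[R]_m, exists2 V, act q V = W & forall X, G (X + V) <-> G X) ->
  mxprob [set X | G X /\ E (act q X)] = (mxprob G * mxprob E)%E.
Proof.
move=> mG pG mE pE GV.
set H := [set X | _].
have mH : mxmeasurable H.
  by rewrite /mxmeasurable /H; apply: measurableI => //;
    exact: mxmeasurable_act.
have pH : mxperiodic H.
  by move=> Z X; rewrite /H/=; have := pG Z X;
    have := @mxperiodic_act n m q E pE Z X; tauto.
pose P1 := cube_prob R (n * m); pose P2 := cube_prob R (1 * m).
(* Q adds an independent uniform W to qX; the two orders of integration give the two sides of the
   claim. *)
pose Q := [set p : (n * m).-tuple RR * (1 * m).-tuple RR |
  G (mx_of_tuple p.1) /\ E (act q (mx_of_tuple p.1) + mx_of_tuple p.2)].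
have mQ : measurable Q.
  apply: measurableI.
    have := measurable_fst (T1 := (n * m).-tuple RR) (T2 := (1 * m).-tuple RR).
    by move=> /(_ measurableT _ mG); rewrite setTI.
  apply: (@measurable_to_mx _ _ _ _
    (fun p : (n * m).-tuple RR * (1 * m).-tuple RR =>
      act q (mx_of_tuple p.1) + mx_of_tuple p.2)) => // i j.
  rewrite (_ : (fun p => _) = (fun p : (n * m).-tuple RR * (1 * m).-tuple RR =>
      act q (mx_of_tuple p.1) i j + mx_of_tuple p.2 i j : RR)); last first.
    by apply/funext => p; rewrite mxE.
  apply: measurable_funD.
    apply: measurable_mulmx_entry => i' j'.
    apply: (measurableT_comp (measurable_mx_entry i' j'));
      exact: measurable_fst.
  apply: (measurableT_comp (measurable_mx_entry i j)); exact: measurable_snd.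
have Q12 : (P1 \x P2)%E Q = (P1 \x^ P2)%E Q.
  by apply: product_measure_unique => //= A B mA mB; rewrite product_measure2E.
(* For fixed W the slice of Q is a translate of H, so every slice has the measure of H. *)
transitivity ((P1 \x^ P2)%E Q).
  rewrite /product_measure2 -[LHS]mul1e -(@probability_setT _ _ _ P2) muleC.
  rewrite -integral_cst//; apply: eq_integral => w _ /=.
  have [V qV GV'] := GV (mx_of_tuple w).
  rewrite -(mxprob_shift V mH pH); congr (cube_prob R _ _).
  apply/funext => t; apply/propext; rewrite /ysection /H/= inE /Q/=.
  rewrite -qV /act -mulmxDr.
  by have := GV' (mx_of_tuple t); tauto.
rewrite -Q12 /product_measure1 /mxprob -/P1 -/P2 muleC.
rewrite -[X in (_ * P1 X)%E]setIT.
rewrite -(@integral_indic _ _ _ P1)//.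
rewrite -ge0_integralZl//; last exact/measurable_EFinP/measurable_indic.
(* For fixed X in G the slice is a translate of E, of measure [mxprob E]; for other X it is
   empty. *)
apply: eq_integral => t _ /=; rewrite indicE.
have [Gt|Gt] := boolP (_ \in _).
  rewrite mule1.
  have := @mxprob_shift 1 m E (act q (mx_of_tuple t)) mE pE.
  rewrite /mxprob => <-; congr (cube_prob R _ _).
  apply/funext => w; apply/propext; rewrite /xsection/= inE /Q/= addrC.
  by move: Gt; rewrite inE/=; tauto.
rewrite mule0 (_ : xsection _ _ = set0) ?measure0//.
apply/seteqP; split => // w; rewrite /xsection/= inE/= => -[Gt' _].
by move: Gt; rewrite notin_setE.
Qed.

End matrix_probability.

(** * Borel-Cantelli for pairwise independent events *)

Section pairwise_borel_cantelli.
Context d (T : measurableType d) (R : realType) (P : probability T R).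
Variable A : (set T)^nat.
Hypothesis mA : forall k, measurable (A k).
Hypothesis indepA : forall i j, i != j
  -> P (A i `&` A j) = (P (A i) * P (A j))%E.

Let p k := fine (P (A k)).

Let PE k : P (A k) = (p k)%:E.
Proof. by rewrite /p fineK// fin_num_measure. Qed.

Let p0 k : 0 <= p k. Proof. by rewrite /p fine_ge0. Qed.

(* Second moment method: with [N] the number of the events that occur and [s]
   its mean, [N ^ 2 + (s + 1) ^ 2 * 1_B >= 2 (s + 1) N] pointwise, because
   [N = 0] outside [B]. *)
Lemma pairwise_indep_union_ge (r : seq nat) (B : set T) : uniq r ->
  measurable B -> (forall i, i \in r -> A i `<=` B) ->
  \sum_(i <- r) p i <= (\sum_(i <- r) p i + 1) * fine (P B).
Proof.
move=> ur mB AB; set s := \sum_(i <- r) p i.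
have s0 : 0 <= s by apply: sumr_ge0.
pose N x : R := \sum_(i <- r) \1_(A i) x.
have mN : measurable_fun [set: T] N by apply: measurable_sum => i;
  exact: measurable_indic.
have N0 x : 0 <= N x by apply: sumr_ge0.
have EN : (\int[P]_x (N x)%:E = s%:E)%E.
  transitivity (\int[P]_x (\sum_(i <- r) (\1_(A i) x)%:E))%E.
    by apply: eq_integral => x _; rewrite sumEFin.
  rewrite ge0_integral_sum//.
  - rewrite /s -sumEFin; apply: eq_bigr => i _.
    by rewrite integral_indic// setIT; exact: PE.
  - by move=> i; exact/measurable_EFinP/measurable_indic.
(* Independence makes each off-diagonal pair contribute p i * p j, and a diagonal pair contributes p
   i; the bound s + s ^ 2 allows both terms on the diagonal. *)
have EN2 : (\int[P]_x ((N x) ^+ 2)%:E <= (s + s ^+ 2)%:E)%E.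
  have -> : (\int[P]_x ((N x) ^+ 2)%:E =
     \int[P]_x (\sum_(i <- r) \sum_(j <- r) (\1_(A i `&` A j) x)%:E))%E.
    apply: eq_integral => x _; rewrite expr2 /N big_distrlr/= -sumEFin.
    apply: eq_bigr => i _; rewrite -sumEFin; apply: eq_bigr => j _.
    by rewrite indicI.
  have mAA i j : measurable (A i `&` A j) by exact: measurableI.
  rewrite ge0_integral_sum//; last 2 first.
  - move=> i; apply: emeasurable_sum => j.
    exact/measurable_EFinP/measurable_indic.
  - by move=> i x _; apply: sume_ge0.
  rewrite (_ : (s + s ^+ 2) = \sum_(i <- r) \sum_(j <- r)
      ((i == j)%:R * p i + p i * p j)); last first.
    rewrite expr2 /s big_distrlr/= -big_split/= !big_seq;
      apply: eq_bigr => i ir.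
    rewrite big_split/=; congr (_ + _).
    rewrite (bigD1_seq i)//= eqxx mul1r big1 ?addr0// => j ji.
    by rewrite eq_sym (negbTE ji) mul0r.
  rewrite -sumEFin; apply: lee_sum => i _.
  rewrite ge0_integral_sum//; last first.
    by move=> j; exact/measurable_EFinP/measurable_indic.
  rewrite -sumEFin; apply: lee_sum => j _.
  rewrite integral_indic// setIT -[leLHS]/(P (A i `&` A j)).
  have [<-|ij] := eqVneq i j.
    by rewrite setIid PE lee_fin mul1r lerDl mulr_ge0.
  by rewrite indepA// !PE mul0r add0r.
have PB : P B = (fine (P B))%:E by rewrite fineK// fin_num_measure.
have : (\int[P]_x (2 * (s + 1) * N x)%:E <=
    \int[P]_x (N x ^+ 2 + (s + 1) ^+ 2 * \1_B x)%:E)%E.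
  apply: ge0_le_integral => //.
  - by move=> x _; rewrite lee_fin !mulr_ge0// addr_ge0.
  - by apply/measurable_EFinP; apply: measurable_funM.
  - apply/measurable_EFinP; apply: measurable_funD;
    first exact: measurable_funX.
    by apply: measurable_funM => //; exact: measurable_indic.
  - move=> x _; rewrite lee_fin indicE.
    have [xB|xB] := boolP (x \in B).
      rewrite mulr1 -subr_ge0; have
        -> : N x ^+ 2 + (s + 1) ^+ 2 - 2 * (s + 1) * N x =
        (N x - (s + 1)) ^+ 2 by ring.
      exact: sqr_ge0.
    rewrite (_ : N x = 0) ?expr0n/= ?mulr0 ?addr0// /N big_seq big1// => i ir.
    rewrite indicE (_ : _ \in _ = false)//; apply/negP => xA.
    by move/negP: xB; apply; move: xA; rewrite !inE; exact: AB.
have -> : (\int[P]_x (2 * (s + 1) * N x)%:E = (2 * (s + 1))%:E * s%:E)%E.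
  rewrite -EN -ge0_integralZl_EFin//.
  - by move=> x _; rewrite lee_fin.
  - exact/measurable_EFinP.
  - by rewrite mulr_ge0// addr_ge0.
have -> : (\int[P]_x (N x ^+ 2 + (s + 1) ^+ 2 * \1_B x)%:E =
    \int[P]_x (N x ^+ 2)%:E + ((s + 1) ^+ 2)%:E * P B)%E.
  transitivity (\int[P]_x ((N x ^+ 2)%:E + ((s + 1) ^+ 2 * \1_B x)%:E))%E.
    by apply: eq_integral => x _; rewrite EFinD.
  rewrite ge0_integralD//.
  - congr (_ + _)%E.
    transitivity (((s + 1) ^+ 2)%:E * \int[P]_x (\1_B x)%:E)%E; last first.
      by rewrite integral_indic// setIT.
    rewrite -ge0_integralZl_EFin//.
    + by apply/measurable_EFinP; exact: measurable_indic.
    + by rewrite sqr_ge0.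
  - by move=> x _; rewrite lee_fin sqr_ge0.
  - by apply/measurable_EFinP; exact: measurable_funX.
  - by move=> x _; rewrite lee_fin mulr_ge0 ?sqr_ge0.
  - by apply/measurable_EFinP; apply: measurable_funM => //;
    exact: measurable_indic.
move=> H; rewrite PB in H.
have {H} : ((2 * (s + 1) * s)%:E
  <= (s + s ^+ 2 + (s + 1) ^+ 2 * fine (P B))%:E)%E.
  by rewrite EFinM (le_trans H)// EFinD leeD// EFinM.
rewrite lee_fin => H.
(* Since s + s ^ 2 = s (s + 1), the inequality can be divided by s + 1. *)
rewrite -(@ler_pM2l _ (s + 1)) ?ltr_wpDl//.
by move: H; nra.
Qed.

(** If a tail union had measure b < 1, the second moment bound s <= (s + 1) b would keep the partial
    sums of the tail at most b / (1 - b), against divergence. So all tail unions, and their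
    decreasing limit, have measure 1. *)
Lemma pairwise_borel_cantelli :
  (\sum_(k <oo) P (A k) = +oo)%E -> P (lim_sup_set A) = 1%E.
Proof.
move=> soo.
have union1 n : P (\bigcup_(j >= n) A j) = 1%E.
  set B := \bigcup_(j >= n) A j.
  have mB : measurable B by apply: bigcup_measurable.
  have PB : P B = (fine (P B))%:E by rewrite fineK// fin_num_measure.
  apply/eqP; rewrite eq_le probability_le1//= PB lee_fin leNgt;
    apply/negP => b1.
  set b := fine (P B) in b1.
  have b0 : 0 <= b by rewrite /b fine_ge0.
  have bound M : \sum_(n <= i < M) p i <= b / (1 - b).
    have := @pairwise_indep_union_ge (index_iota n M) B (iota_uniq _ _) mB.
    rewrite -/b; set s := \sum_(_ <- _) _ => H.
    rewrite ler_pdivlMr ?subr_gt0//.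
    have {}H : s <= (s + 1) * b.
      by apply: H => i; rewrite mem_index_iota => /andP[ni _];
        exact: bigcup_sup.
    by move: H; nra.
  suff : (\sum_(k <oo) P (A k) < +oo)%E by rewrite soo ltxx.
  rewrite (nneseries_split 0 n)//; apply: lte_add_pinfty.
    under eq_bigr do rewrite PE.
    by rewrite sumEFin ltry.
  rewrite add0n.
  apply: (@le_lt_trans _ _ (b / (1 - b))%:E); last exact: ltry.
  apply: lime_le; first exact: is_cvg_nneseries.
  apply: nearW => M; under eq_bigr do rewrite PE.
  by rewrite sumEFin lee_fin.
have mU n : measurable (\bigcup_(j >= n) A j) by apply: bigcup_measurable.
have fin0 : (P (\bigcup_(j >= 0) A j) < +oo)%E by rewrite union1 ltry.
have := lim_sup_set_cvg P A mA fin0.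
rewrite (_ : (fun n => _) = cst 1%E); last by apply/funext => n; exact: union1.
by move=> /cvg_lim <-//; rewrite lim_cst.
Qed.

End pairwise_borel_cantelli.

(** * Primitive integer rows *)

Section integer_rows.
Variable n : nat.
Implicit Types q : 'rV[int]_n.

Lemma scale_int_row_inj (a : int) : a != 0 -> injective (fun q => a *: q).
Proof.
move=> a0 q q' /rowP E; apply/rowP => i; apply: (mulfI a0).
by have := E i; rewrite !mxE.
Qed.

Lemma gcd_row_gt0 q : q != 0 -> (0 < gcd_row q)%N.
Proof.
move=> q0; have [i qi] : exists i, q ord0 i != 0 by exact/rV0Pn.
have : (gcd_row q %| `|q ord0 i|)%N by rewrite /gcd_row (bigD1 i)//= dvdn_gcdl.
by apply: dvdn_gt0; rewrite absz_gt0.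
Qed.

Lemma dvdn_gcd_row q i : (gcd_row q %| `|q ord0 i|)%N.
Proof. by rewrite /gcd_row (bigD1 i)//= dvdn_gcdl. Qed.

Lemma gcd_row_scale (a : int) q : gcd_row (a *: q) = (`|a| * gcd_row q)%N.
Proof.
rewrite /gcd_row (big_morph (fun x => (`|a| * x)%N) (id1 := 0%N) (op1 := gcdn)).
- by apply: eq_bigr => i _; rewrite mxE abszM.
- by move=> x y; rewrite muln_gcdr.
- by rewrite muln0.
Qed.

Lemma gcd_row0 : gcd_row (0 : 'rV[int]_n) = 0%N.
Proof. by rewrite -(scale0r (0 : 'rV[int]_n)) gcd_row_scale. Qed.

Let base q : 'rV[int]_n := \row_i (q ord0 i %/ (gcd_row q)%:Z)%Z.

(* Of the two primitive generators [+-p] of a rational line, the one with the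
   smaller code is chosen. *)
Definition row_sign q : int :=
  if (pickle (base q) <= pickle (- base q))%N then 1 else - 1.

Definition prim_row q : 'rV[int]_n := row_sign q *: base q.

Definition row_mult q : int := row_sign q * (gcd_row q)%:Z.

Let base_scale q : (gcd_row q)%:Z *: base q = q.
Proof.
apply/rowP => i; rewrite !mxE mulrC divzK//.
exact: dvdn_gcd_row.
Qed.

Lemma row_multK q : row_mult q *: prim_row q = q.
Proof.
rewrite /row_mult /prim_row scalerA -mulrA (mulrC _ (row_sign q)) mulrA.
rewrite (_ : row_sign q * row_sign q = 1) ?mul1r ?base_scale//.
by rewrite /row_sign; case: ifP.
Qed.

Lemma abs_row_mult q : `|row_mult q|%N = gcd_row q.
Proof. by rewrite abszM /row_sign; case: ifP => _ /=;
  rewrite ?abszN ?mul1n. Qed.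

Lemma row_mult_eq0 q : (row_mult q == 0) = (q == 0).
Proof.
apply/eqP/eqP => [q0|->].
  by rewrite -(row_multK q) q0 scale0r.
by apply/eqP; rewrite -absz_eq0 abs_row_mult gcd_row0.
Qed.

Lemma gcd_prim_row q : q != 0 -> gcd_row (prim_row q) = 1%N.
Proof.
move=> q0; have := congr1 (@gcd_row n) (row_multK q).
rewrite gcd_row_scale abs_row_mult -[RHS]muln1 => /eqP.
by rewrite eqn_pmul2l ?gcd_row_gt0// => /eqP.
Qed.

Lemma pickle_prim_row q : (pickle (prim_row q) <= pickle (- prim_row q))%N.
Proof.
rewrite /prim_row /row_sign; case: ifP => [|/negbT]; rewrite ?scale1r//.
by rewrite scaleN1r opprK -ltnNge => /ltnW.
Qed.

(** Proportional primitive rows agree up to sign, by taking gcds in p'_j p = p_j p'. If they were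
    opposite, the choice of the smaller code would give p' and -p' the same code. *)
Lemma prim_row_parallel q q' : q != 0 -> q' != 0 ->
  (forall i j, prim_row q ord0 i * prim_row q' ord0 j =
               prim_row q ord0 j * prim_row q' ord0 i) ->
  prim_row q = prim_row q'.
Proof.
move=> q0 q'0 par; set p := prim_row q; set p' := prim_row q'.
have gp : gcd_row p = 1%N by exact: gcd_prim_row.
have gp' : gcd_row p' = 1%N by exact: gcd_prim_row.
have [j p'j] : exists j, p' ord0 j != 0.
  by apply/rV0Pn; apply/eqP => p'0; move: gp'; rewrite p'0 gcd_row0.
have E : p' ord0 j *: p = p ord0 j *: p'.
  by apply/rowP => i; rewrite [LHS]mxE [RHS]mxE mulrC; exact: par.
have := congr1 (@gcd_row n) E;
  rewrite (gcd_row_scale _ p) (gcd_row_scale _ p') gp gp' !muln1 => abs_eq.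
have [pj|pj] : p' ord0 j = p ord0 j \/ p' ord0 j = - p ord0 j by lia.
  by apply: (scale_int_row_inj p'j); rewrite E pj.
have pp' : p = - p'.
  by apply: (scale_int_row_inj p'j); rewrite E pj scalerN scaleNr opprK.
have h1 := pickle_prim_row q; have h2 := pickle_prim_row q'.
rewrite -/p -/p' in h1 h2; rewrite pp' opprK in h1.
have : pickle (- p') = pickle p' by apply/eqP; rewrite eqn_leq h1.
by move/(pcan_inj pickleK) => <-.
Qed.

End integer_rows.

(** Cramer's rule with the nonzero minor D. Adding v W to X shifts pX by W and leaves p'X fixed,
    which is what independence needs. *)
Lemma row_dual_pair (R : realType) n (p p' : 'rV[int]_n) i j :
  p ord0 i * p' ord0 j != p ord0 j * p' ord0 i ->
  exists v : 'cV[R]_n, map_mx intr p *m v = 1%:M /\ map_mx intr p' *m v = 0.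
Proof.
move=> pp'.
pose D : R := (p ord0 i * p' ord0 j - p ord0 j * p' ord0 i)%:~R.
have D0 : D != 0 by rewrite intr_eq0 subr_eq0.
pose e (k : 'I_n) : 'cV[R]_n := delta_mx k ord0.
have re (q : 'rV[int]_n) k : map_mx intr q *m e k
  = ((q ord0 k)%:~R)%:M :> 'M[R]_1.
  apply/matrixP => a b; rewrite !ord1 !mxE (bigD1 k)//= !mxE !eqxx mulr1 big1
    ?addr0//.
  by move=> l lk; rewrite !mxE (negbTE lk) mulr0.
exists (D^-1 *: ((p' ord0 j)%:~R *: e i - (p' ord0 i)%:~R *: e j)).
split; rewrite -scalemxAr mulmxBr -!scalemxAr !re !scale_scalar_mx -raddfB/=
  scale_scalar_mx.
  congr scalar_mx; rewrite -!intrM -intrB.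
  by rewrite (mulrC _ (p ord0 i)) (mulrC _ (p ord0 j)) mulVf.
by rewrite [X in _ * (X - _)]mulrC subrr mulr0 raddf0.
Qed.

(** * Measurability of limsup sets *)

(** This form shows a limsup set as a countable intersection of countable unions, hence as
    measurable. *)
Lemma infinite_set_pickleP (T : countType) (S : set T) :
  infinite_set S <-> forall N, exists2 q, S q & (N <= pickle q)%N.
Proof.
split=> [infS N|H /finite_seqP[s sE]].
  apply: contrapT => H; apply: infS.
  apply: (@sub_finite_set _ _ [set` pmap (@unpickle T) (iota 0 N)]) =>
    // q Sq /=.
  rewrite mem_pmap; apply/mapP; exists (pickle q); last by rewrite pickleK.
  by rewrite mem_iota/= add0n ltnNge; apply/negP => Nq; apply: H; exists q.
have [q] := H (\max_(x <- s) pickle x).+1; rewrite sE /= => qs.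
by rewrite ltnNge (@leq_bigmax_seq _ s xpredT pickle q qs).
Qed.

Section measurable_matrix_sets.
Variables (R : realType) (n m : nat).
Implicit Types S G : set 'M[R]_(n, m).
Local Notation RR := (measurableTypeR R).

Lemma mxmeasurable_exists (I : countType) (F : I -> set 'M[R]_(n, m)) :
  (forall i, mxmeasurable (F i)) -> mxmeasurable [set X | exists i, F i X].
Proof.
move=> mF; rewrite /mxmeasurable.
have -> : @mx_of_tuple R n m @^-1` [set X | exists i, F i X] =
    \bigcup_(i in [set: I]) (@mx_of_tuple R n m @^-1` F i).
  by apply/seteqP; split => [t [i Fi]|t [i _ Fi]]; exists i.
by apply: countable_bigcupT_measurable => //; exact: countableP.
Qed.

Lemma mxmeasurable_and (P : Prop) S :
  mxmeasurable S -> mxmeasurable [set X | P /\ S X].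
Proof.
move=> mS; have [p|np] := pselect P.
  rewrite (_ : [set X | _] = S)//.
  by apply/seteqP; split => // X [].
rewrite (_ : [set X | _] = set0); last by apply/seteqP; split => // X [].
by rewrite /mxmeasurable preimage_set0.
Qed.

Lemma mxmeasurable_infinite (I : countType) (F : I -> set 'M[R]_(n, m)) :
  (forall i, mxmeasurable (F i)) ->
  mxmeasurable [set X | infinite_set [set i | F i X]].
Proof.
move=> mF; rewrite /mxmeasurable.
have -> : @mx_of_tuple R n m @^-1` [set X | infinite_set [set i | F i X]] =
    \bigcap_N (@mx_of_tuple R n m @^-1`
      [set X | exists i, (N <= pickle i)%N /\ F i X]).
  apply/seteqP; split => [t /= /infinite_set_pickleP H N _|t H].
    by have [i Fi Ni] := H N; exists i.
  by apply/infinite_set_pickleP => N; have [i [Ni Fi]] := H N Logic.I; exists i.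
apply: bigcapT_measurable => N.
by apply: mxmeasurable_exists => i; exact: mxmeasurable_and.
Qed.

Lemma le_mxprob S G : mxmeasurable S -> mxmeasurable G -> S `<=` G ->
  (mxprob S <= mxprob G)%E.
Proof. by move=> mS mG SG; apply: le_measure; rewrite ?inE// => t;
  exact: SG. Qed.

Lemma mxprob_le1 S : mxmeasurable S -> (mxprob S <= 1)%E.
Proof. by move=> mS; apply: probability_le1. Qed.

Lemma mxprob_setT : mxprob [set: 'M[R]_(n, m)] = 1%E.
Proof. by rewrite /mxprob preimage_setT probability_setT. Qed.

Lemma mxmeasurable_setT : mxmeasurable [set: 'M[R]_(n, m)].
Proof. by rewrite /mxmeasurable preimage_setT. Qed.

End measurable_matrix_sets.

(** * Uniform distribution and pairwise independence of the points pX *)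

Section act_distribution.
Variables (R : realType) (n m : nat).

(** Placing W / p_i in a row i with p_i nonzero gives V with pV = W, so [mxprob_act_indep] applies
    with the whole space as G. *)
Lemma mxprob_act (p : 'rV[int]_n) (E : set 'rV[R]_m) : p != 0 ->
  mxmeasurable E -> mxperiodic E ->
  mxprob [set X : 'M[R]_(n, m) | E (act p X)] = mxprob E.
Proof.
move=> p0 mE pE.
have [i pi0] : exists i, p ord0 i != 0 by exact/rV0Pn.
have dual (W : 'rV[R]_m) : exists2 V : 'M[R]_(n, m), act p V
  = W & forall X, setT (X + V) <-> setT X.
  exists ((p ord0 i)%:~R^-1 *: (delta_mx i ord0 *m W)) => //.
  rewrite /act -scalemxAr mulmxA (_ : _ *m delta_mx i ord0 = (p ord0 i)%:~R%:M).
    by rewrite mul_scalar_mx scalerA mulVf ?intr_eq0// scale1r.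
  apply/matrixP => a b; rewrite !ord1 !mxE (bigD1 i)//= !mxE !eqxx mulr1 big1
    ?addr0//.
  by move=> l li; rewrite !mxE (negbTE li) mulr0.
have := mxprob_act_indep (@mxmeasurable_setT R n m) (fun _ _ =>
  iff_refl _) mE pE dual.
rewrite mxprob_setT mul1e => <-; congr mxprob.
by apply/seteqP; split => // X [].
Qed.

(** In [mxprob_act_indep] take V = v W with p v = 1 and p' v = 0. *)
Lemma mxprob_act2 (p p' : 'rV[int]_n) i j (E E' : set 'rV[R]_m) :
  p ord0 i * p' ord0 j != p ord0 j * p' ord0 i ->
  mxmeasurable E -> mxperiodic E -> mxmeasurable E' -> mxperiodic E' ->
  mxprob [set X : 'M[R]_(n, m) | E' (act p' X) /\ E (act p X)] =
    (mxprob [set X : 'M[R]_(n, m) | E' (act p' X)] * mxprob E)%E.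
Proof.
move=> pp' mE pE mE' pE'.
apply: mxprob_act_indep => //; first exact: mxmeasurable_act.
  exact: mxperiodic_act.
have [v [pv p'v]] := row_dual_pair R pp'.
move=> W; exists (v *m W) => [|X]; first by rewrite /act mulmxA pv mul1mx.
by rewrite /= /act mulmxDr mulmxA p'v mul0mx addr0.
Qed.

End act_distribution.

(** * Neighbourhoods of y + Z^m and passage from the torus to periodic sets *)

Section target.
Variables (R : realType) (m : nat) (y : 'rV[R]_m).
Local Notation RR := (measurableTypeR R).

Definition target (r : R) : set 'rV[R]_m :=
  [set b + p | b in ball (0 : 'rV[R]_m) r & p in Pset y].

(** The clause 0 < r is part of the matrix ball; it makes the target of radius 0 empty. *)
Lemma targetP r z : target r z <-> exists p : 'rV[int]_m,
  0 < r /\ forall j, `|z ord0 j - y ord0 j - (p ord0 j)%:~R| < r.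
Proof.
split=> [[b br [_ [p _ <-] <-]]|[p [r0 H]]].
  case: br => r0 br; exists p; split => // j.
  by have := br ord0 j; rewrite /ball/= !mxE sub0r normrN addrA addrAC addrK
    addrK.
exists (z - y - map_mx intr p).
  split => // i j; rewrite ord1 /ball/= [in X in X - _]mxE sub0r normrN.
  by have := H j; rewrite !mxE.
by exists (y + map_mx intr p);
  [exists p|rewrite -[z - y - _]addrA -opprD subrK].
Qed.

Lemma mxperiodic_target r : mxperiodic (target r).
Proof.
move=> Z z; split=> /targetP[p [r0 H]]; apply/targetP.
  exists (p - Z); split => // j; have := H j; rewrite !mxE intrB.
  by congr (`|_| < _); ring.
exists (p + Z); split => // j; have := H j; rewrite !mxE intrD.
by congr (`|_| < _); ring.
Qed.

Lemma mxmeasurable_target r : mxmeasurable (target r).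
Proof.
have -> : target r = [set z | exists p : 'rV[int]_m, 0 < r /\
    [set z : 'rV[R]_m | forall j, `|z ord0 j - y ord0 j - (p ord0 j)%:~R| < r]
      z].
  by apply/funext => z; apply/propext/targetP.
apply: mxmeasurable_exists => p; apply: mxmeasurable_and; rewrite /mxmeasurable.
rewrite (_ : _ @^-1` _ = \bigcap_(j in [set: 'I_m]) [set t : (1 * m).-tuple RR |
    ball (y ord0 j + (p ord0 j)%:~R) r (mx_of_tuple t ord0 j)]).
  apply: fin_bigcap_measurable => // j _.
  have := @measurable_mx_entry R 1 m ord0 j measurableT _
    (measurable_ball (y ord0 j + (p ord0 j)%:~R) r).
  by rewrite setTI.
apply/seteqP; split => [t H j _|t H j] /=.
  by rewrite /ball/= distrC opprD addrA; exact: H.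
by have := H j Logic.I; rewrite /= /ball/= distrC opprD addrA.
Qed.

(** The limsup set is periodic, so membership of a class does not depend on its representative. *)
Lemma leb_torus_Wset n (psi : 'rV[int]_n -> R) :
  leb_torus (Wset y psi) =
  mxprob [set X : 'M[R]_(n, m) | infinite_set [set q | target (psi q) (act q
    X)]].
Proof.
set L := [set X : 'M[R]_(n, m) | _].
have mL : mxmeasurable L.
  apply: mxmeasurable_infinite => q; apply: mxmeasurable_act.
  exact: mxmeasurable_target.
have pL : mxperiodic L.
  move=> Z X; rewrite /L /=.
  rewrite (_ : [set q | _] = [set q | target (psi q) (act q X)])//.
  apply/funext => q; apply/propext.
  by have := @mxperiodic_act R n m q _ (@mxperiodic_target (psi q)) Z X.
rewrite -lebesgue_mx_cube// /leb_torus; congr lebesgue_mx; congr setI.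
apply/funext => X; apply/propext; split => /= [[X' LX' /eqmodP]|LX];
  last by exists X.
move=> /asboolP[Z XZ].
have -> : X = X' + map_mx intr (- Z) by rewrite map_mxN -XZ opprB addrC subrK.
exact/pL.
Qed.

End target.

(** * Comparison of sums, and dilation by primes *)

(** Divergence is carried along an injection: each finite sum of f is at most c times a finite sum
    of g over the image. *)
Lemma esum_eqy_transfer (R : realType) (I J : choiceType) (G : set I) (D :
  set J)
    (h : I -> J) (f : I -> \bar R) (g : J -> \bar R) (c : R) :
  0 <= c -> set_inj G h -> (forall i, G i -> D (h i)) ->
  (forall j, (0 <= g j)%E) ->
  (forall i, G i -> (f i <= c%:E * g (h i))%E) ->
  (\esum_(i in G) f i = +oo)%E -> (\esum_(j in D) g j = +oo)%E.
Proof.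
move=> c0 hinj hD g0 fg fy; apply/eqP; rewrite -leye_eq leNgt;
  apply/negP => gfin.
have g0' : (0 <= \esum_(j in D) g j)%E by apply: esum_ge0.
have /fineK gE : (\esum_(j in D) g j)%E \is a fin_num by rewrite ge0_fin_numE.
suff : (\esum_(i in G) f i <= (c * fine (\esum_(j in D) g j))%:E)%E.
  by rewrite fy leye_eq.
apply: ge_ereal_sup => _ [X [finX XG] <-].
apply: (@le_trans _ _ (\sum_(i \in X) c%:E * g (h i))%E).
  by apply: lee_fsum => // i /XG; exact: fg.
rewrite -ge0_mule_fsumr//.
rewrite EFinM gE lee_wpmul2l ?lee_fin//.
rewrite -esum_fset//.
rewrite -(@esum_image _ _ _ X h g); last first.
  by move=> i j /set_mem/XG Gi /set_mem/XG Gj; apply: hinj; rewrite inE.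
apply: ge_ereal_sup => _ [Y [finY YX] <-]; apply: ereal_sup_ubound;
  exists Y => //.
by split => // j /YX[i /XG Gi <-]; exact: hD.
Qed.

(** Finite parts will have bounded gcds. Half of a positive finite sum lies strictly below the
    supremum defining it; a zero sum takes the empty set. *)
Lemma esum_finite_half (R : realType) (I : choiceType) (S : set I)
    (f : I -> \bar R) : (forall i, (0 <= f i)%E) ->
  (\esum_(i in S) f i < +oo)%E ->
  exists F : set I, [/\ finite_set F, F `<=` S &
    (\esum_(i in S) f i <= 2%:E * \esum_(i in F) f i)%E].
Proof.
move=> f0 ffin; have e0 : (0 <= \esum_(i in S) f i)%E by apply: esum_ge0.
have [s0|s0] := eqVneq (\esum_(i in S) f i)%E 0%E.
  by exists set0; split => //; rewrite s0 esum_set0 mule0.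
have fE : (\esum_(i in S) f i = (fine (\esum_(i in S) f i))%:E)%E.
  by rewrite fineK// ge0_fin_numE.
set s := fine _ in fE.
have s_gt0 : 0 < s by rewrite -lte_fin -fE lt_def s0.
have : ((s / 2)%:E < \esum_(i in S) f i)%E.
  by rewrite fE lte_fin; lra.
move=> /ereal_sup_gt[_ [F [finF FS] <-]] sF.
exists F; split => //; rewrite (esum_fset finF)//.
rewrite fE (_ : s = 2 * (s / 2)); last by field.
by rewrite EFinM lee_wpmul2l ?lee_fin// ltW.
Qed.

(** This is qX = d(pX), with the integer d written as a row of length 1. *)
Lemma act_scale (R : realType) n m a (p : 'rV[int]_n) (X : 'M[R]_(n, m)) :
  act (a *: p) X = act (const_mx a : 'rV_1) (act p X).
Proof.
rewrite /act map_mxZ -scalemxAl; apply/rowP => j.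
by rewrite [LHS]mxE [RHS]mxE big_ord1 !mxE.
Qed.

Lemma row1_const (e : 'rV[int]_1) : e = const_mx (e ord0 ord0).
Proof. by apply/rowP => i; rewrite ord1 mxE. Qed.

Lemma gcd_row_const (a : int) : gcd_row (const_mx a : 'rV_1) = `|a|%N.
Proof. by rewrite /gcd_row big_ord1 mxE. Qed.

Lemma const_row1_eq0 (a : int) : ((const_mx a : 'rV[int]_1) == 0) = (a == 0).
Proof.
apply/eqP/eqP => [/rowP/(_ ord0)|->]; first by rewrite !mxE.
by apply/rowP => i; rewrite !mxE.
Qed.

(* Increasing primes [N k > D k] keep the dilated supports disjoint. *)
Lemma increasing_primes (D : nat -> nat) : exists N : nat -> nat,
  [/\ forall k, prime (N k), forall k, (D k < N k)%N &
      forall j k, (j < k)%N -> (N j < N k)%N].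
Proof.
pose next k := s2val (prime_above k).
have nextP k : (k < next k)%N /\ prime (next k) by rewrite /next;
  case: prime_above.
pose N := fix N k := if k is k'.+1 then next (maxn (N k') (D k)) else next (D
  0%N).
exists N; split.
- by case=> [|k]; exact: (nextP _).2.
- case=> [|k]; first exact: (nextP _).1.
  by apply: leq_ltn_trans (nextP _).1; exact: leq_maxr.
- move=> j; elim=> // k IH; rewrite ltnS leq_eqVlt => /orP[/eqP->|jk].
    by apply: leq_ltn_trans (nextP _).1; exact: leq_maxl.
  apply: (ltn_trans (IH jk)).
  by apply: leq_ltn_trans (nextP _).1; exact: leq_maxl.
Qed.

(** For a prime N not dividing d the ratio changes by the factor 1 - 1/N, which is at least 1/2. *)
Lemma totient_prime_mul_ratio (R : realType) (N d : nat) : prime N ->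
  (0 < d)%N -> (d < N)%N ->
  (totient d)%:R / d%:R <= 2 * ((totient (N * d))%:R / (N * d)%:R) :> R.
Proof.
move=> pN d0 dN.
have cop : coprime N d.
  by rewrite prime_coprime//; apply/negP => /(dvdn_leq d0); rewrite leqNgt dN.
have N1 := prime_gt1 pN; have NR : (0 : R) < N%:R by rewrite ltr0n; lia.
rewrite totient_coprime// (totient_prime pN) !natrM invfM mulrACA [leRHS]mulrA.
rewrite -[leLHS]mul1r; apply: ler_wpM2r; first by rewrite mulr_ge0// invr_ge0.
rewrite mulrA ler_pdivlMr// mul1r -(natrM _ 2) ler_nat; lia.
Qed.

(** * Reduction to one row *)

Section weight.
Variables (R : realType) (m : nat).

Definition weight n (psi : 'rV[int]_n -> R) (q : 'rV[int]_n) : R :=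
  ((totient (gcd_row q))%:R * psi q / (gcd_row q)%:R) ^+ m.

Lemma weight_ge0 n (psi : 'rV[int]_n -> R) q : 0 <= psi q -> 0 <= weight psi q.
Proof. by move=> p0; rewrite exprn_ge0// !mulr_ge0// invr_ge0. Qed.

Lemma weight_dilate_le n (psi : 'rV[int]_n -> R) (Psi : 'rV[int]_1 -> R) q N :
  q != 0 -> 0 <= psi q -> prime N -> (gcd_row q < N)%N ->
  Psi (const_mx (N%:Z * row_mult q)) = psi q ->
  weight psi q <= 2 ^+ m * weight Psi (const_mx (N%:Z * row_mult q)).
Proof.
move=> q0 p0 pN qN PsiE; rewrite /weight PsiE -exprMn.
apply: lerXn2r; rewrite ?nnegrE ?mulr_ge0 ?invr_ge0//.
rewrite gcd_row_const abszM abs_row_mult absz_nat !(mulrAC _ (psi q)) mulrA.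
by rewrite ler_wpM2r// totient_prime_mul_ratio// gcd_row_gt0.
Qed.

End weight.

Section reduction.
Variables (R : realType) (m : nat) (y : 'rV[R]_m) (n : nat).
Variable psi : 'rV[int]_n -> R.
Hypothesis psi0 : forall q, 0 <= psi q.
Hypothesis W1 : WIDSC 1 y.

Let f q : \bar R := (weight m psi q)%:E.
Let L := [set X : 'M[R]_(n, m) | infinite_set [set q | target y (psi q) (act q
  X)]].
(** Lines through the origin are numbered by the code of their chosen primitive generator, which
    turns families of lines into sequences. *)
Let line_code (q : 'rV[int]_n) := pickle (prim_row q).
Let line k : set 'rV[int]_n := [set q | q != 0 /\ line_code q = k].
(** The default 0 is taken at numbers that code no row; [line k] is then empty. *)
Let gen k : 'rV[int]_n := odflt 0 (unpickle k).

Let f0 q : (0 <= f q)%E. Proof. by rewrite lee_fin weight_ge0. Qed.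

Let gen_line_code q : gen (line_code q) = prim_row q.
Proof. by rewrite /gen /line_code pickleK. Qed.

(** The V_p of the outline, with p numbered k and d = [row_mult q]. *)
Let V k : set 'rV[R]_m := [set z | exists q, line k q /\
  target y (psi q) (act (const_mx (row_mult q) : 'rV_1) z)].

Let mV k : mxmeasurable (V k).
Proof.
apply: mxmeasurable_exists => q; apply: mxmeasurable_and;
  apply: mxmeasurable_act.
exact: mxmeasurable_target.
Qed.

Let pV k : mxperiodic (V k).
Proof.
move=> Z z; have pq (q : 'rV[int]_n) := mxperiodic_act
  (const_mx (row_mult q) : 'rV_1) (@mxperiodic_target _ _ y (psi q)) Z z.
by split=> -[q [kq H]]; exists q; split=> //; apply/pq.
Qed.

Let mL : mxmeasurable L.
Proof.
apply: mxmeasurable_infinite => q; apply: mxmeasurable_act.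
exact: mxmeasurable_target.
Qed.

Let prim_row_neq0 (q : 'rV[int]_n) : q != 0 -> prim_row q != 0.
Proof.
by move=> q0; apply/eqP => p0; have := gcd_prim_row q0; rewrite p0 gcd_row0.
Qed.

Let L1 (Psi : 'rV[int]_1 -> R) : set 'rV[R]_m :=
  [set z | infinite_set [set e | target y (Psi e) (act e z)]].

Let mL1 Psi : mxmeasurable (L1 Psi).
Proof.
apply: mxmeasurable_infinite => q; apply: mxmeasurable_act.
exact: mxmeasurable_target.
Qed.

Let pL1 Psi : mxperiodic (L1 Psi).
Proof.
move=> Z X; rewrite /L1 /=.
rewrite (_ : [set q | _] = [set q | target y (Psi q) (act q X)])//.
apply/funext => q; apply/propext.
by have := @mxperiodic_act R 1 m q _ (@mxperiodic_target _ _ y (Psi q)) Z X.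
Qed.

Let full_L1 (Psi : 'rV[int]_1 -> R) : (forall e, 0 <= Psi e) ->
  (\esum_(e in [set e : 'rV[int]_1 | e != 0%R]) (weight m Psi e)%:E = +oo)%E ->
  mxprob (L1 Psi) = 1%E.
Proof. by move=> P0 Poo; rewrite -[LHS]leb_torus_Wset; exact: W1. Qed.

(** With Psi(d) = psi(d p), the one-row hypothesis gives infinitely many solutions d for almost
    every z; since pX is uniform, this holds at z = pX for almost every X. *)
Lemma full_of_divergent_line k :
  (\esum_(q in line k) f q = +oo)%E -> mxprob L = 1%E.
Proof.
move=> oo.
(* A divergent sum is not over an empty line, so k codes a primitive row. *)
have gen0 : gen k != 0.
  apply/eqP => g0; move: oo; rewrite (_ : line k = set0) ?esum_set0//.
  apply/seteqP; split => // q [q0 qk].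
  by have := prim_row_neq0 q0; rewrite -gen_line_code qk g0 eqxx.
have row_gen q : line k q -> row_mult q *: gen k = q.
  by move=> [_ <-]; rewrite gen_line_code row_multK.
pose Psi (e : 'rV[int]_1) := psi (e ord0 ord0 *: gen k).
have PsiE q : line k q -> Psi (const_mx (row_mult q)) = psi q.
  by move=> kq; rewrite /Psi mxE row_gen.
have full : mxprob (L1 Psi) = 1%E.
  apply: full_L1 => [e|]; first exact: psi0.
  apply: (esum_eqy_transfer (h := fun q => const_mx (row_mult q))
    (G := line k) (f := f) (c := 1)) => //.
  - move=> q q' /set_mem kq /set_mem kq' /rowP/(_ ord0); rewrite !mxE => qq'.
    by rewrite -(row_gen q)// -(row_gen q')// qq'.
  - by move=> q [q0 _]; rewrite /= const_row1_eq0 row_mult_eq0.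
  - by move=> e; rewrite lee_fin weight_ge0// psi0.
  - move=> q kq; rewrite mul1e lee_fin /f /weight PsiE//.
    by rewrite gcd_row_const abs_row_mult.
apply/eqP; rewrite eq_le mxprob_le1//= -full.
rewrite -(mxprob_act (n := n) gen0 (mL1 Psi) (@pL1 Psi)).
apply: le_mxprob => //; first exact: mxmeasurable_act.
move=> X /= infX finL; apply: infX.
apply: (@sub_finite_set _ _ ((fun e : 'rV[int]_1 => e ord0 ord0 *: gen k) @^-1`
    [set q | target y (psi q) (act q X)])).
  by move=> e /=; rewrite act_scale -row1_const.
(* The map d -> d p is injective, so infinitely many d give infinitely many q. *)
apply: finite_preimage => // e e' _ _ ee'.
rewrite (row1_const e) (row1_const e'); congr const_mx.
have [j gj] : exists j, gen k ord0 j != 0 by exact/rV0Pn.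
by apply: (mulIf gj); have := congr1 (fun r : 'rV[int]_n => r ord0 j) ee';
  rewrite /= !mxE.
Qed.

(** The events that pX lies in V_p keep the measures of the V_p and are pairwise independent, so
    Borel-Cantelli applies; different lines provide different q. *)
Lemma full_of_divergent_measures :
  (\sum_(k <oo) mxprob (V k) = +oo)%E -> mxprob L = 1%E.
Proof.
move=> oo.
pose U k := [set X : 'M[R]_(n, m) | V k (act (gen k) X)].
have mU k : mxmeasurable (U k) by exact: mxmeasurable_act.
(* A number k that codes no chosen generator has empty [V k], which settles measure and independence
   whatever [gen k] is. *)
have V0P k : V k = set0 \/ exists2 q, q != 0 & line_code q = k.
  have [[z [q [[q0 qk] _]]]|H] := pselect (V k !=set0).
    by right; exists q.
  by left; apply/seteqP; split => // z Vz; case: H; exists z.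
have UV k : mxprob (U k) = mxprob (V k).
  have [VE|[q q0 qk]] := V0P k.
    by rewrite /mxprob /U VE /= !preimage_set0 !measure0.
  by rewrite mxprob_act// -qk gen_line_code prim_row_neq0.
have indep i j : i != j ->
    mxprob (U i `&` U j) = (mxprob (U i) * mxprob (U j))%E.
  move=> ij.
  have U0 k : V k = set0 -> U k = set0 by move=> VE; rewrite /U VE.
  have m0 : mxprob (set0 : set 'M[R]_(n, m))
    = 0%E by rewrite /mxprob preimage_set0 measure0.
  have [/U0->|[q q0 qi]] := V0P i; first by rewrite set0I m0 mul0e.
  have [/U0->|[q' q'0 qj]] := V0P j; first by rewrite setI0 m0 mule0.
  have [a [b ab]] : exists a b, gen j ord0 a * gen i ord0 b
    != gen j ord0 b * gen i ord0 a.
    apply: contrapT => H; case/negP: ij; rewrite -qi -qj /line_code.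
    rewrite (@prim_row_parallel _ q q')// => a b.
    apply/eqP; apply: contrapT => /negP ab; apply: H; exists b, a.
    by rewrite -qi -qj !gen_line_code mulrC [X in _ != X]mulrC.
  by rewrite (UV j) -(mxprob_act2 ab (mV j) (@pV j) (mV i) (@pV i)).
have full : cube_prob R (n * m)
    (lim_sup_set (fun k => @mx_of_tuple R n m @^-1` U k)) = 1%E.
  apply: pairwise_borel_cantelli; [exact: mU|exact: indep|].
  by rewrite -[RHS]oo; apply: eq_eseriesr => k _; exact: UV.
apply/eqP; rewrite eq_le mxprob_le1//= -full.
apply: le_measure; rewrite ?inE//.
  by apply: bigcap_measurable => // k _; apply: bigcup_measurable => j _;
    exact: mU.
move=> t limt /finite_seqP[s sE].
(* If all solutions q were in the finite list s, a line numbered beyond all codes in s would still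
   provide one. *)
have [k /= ks [q [[q0 qk] /= Tq]]] :=
  limt (\max_(x <- s) line_code x).+1 Logic.I.
have qs : q \in s.
  suff : [set` s] q by [].
  rewrite -sE /=; have := act_scale (row_mult q) (prim_row q) (mx_of_tuple t).
  by rewrite row_multK -gen_line_code qk => ->.
have := @leq_bigmax_seq _ s xpredT line_code q qs isT.
by rewrite qk leqNgt ks.
Qed.

(** If the measures were summable, so would be those of the preimages of [V k] under z -> N_k z, and
    their limsup would be null; but it contains a set of full measure given by the one-row
    hypothesis. *)
Lemma divergent_measures :
  (\esum_(q in [set q : 'rV[int]_n | q != 0%R]) f q = +oo)%E ->
  (forall k, \esum_(q in line k) f q < +oo)%E ->
  (\sum_(k <oo) mxprob (V k) = +oo)%E.
Proof.
move=> oo linefin; apply/eqP; rewrite -leye_eq leNgt; apply/negP => Vfin.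
have [F FP] := choice (fun k => esum_finite_half f0 (linefin k)).
have finF k : finite_set (F k) by have [] := FP k.
have Fline k : F k `<=` line k by have [] := FP k.
have bound k : exists D, forall q, F k q -> (gcd_row q <= D)%N.
  have /finite_seqP[s sE] := finF k.
  exists (\max_(q <- s) gcd_row q) => q; rewrite sE /= => qs.
  exact: (@leq_bigmax_seq _ s xpredT (@gcd_row n) q qs).
have [D DP] := choice bound.
have [N [pN DN incN]] := increasing_primes D.
pose G := \bigcup_k F k.
have GF q : G q -> F (line_code q) q.
  by move=> [k _ Fkq]; have [_ ->] := Fline _ _ Fkq.
have G0 q : G q -> q != 0 by move=> /GF/Fline[].
(* Each line keeps a finite part with at least half of its sum, whence the constant 2. *)
have Goo : (\esum_(q in G) f q = +oo)%E.
  rewrite esum_bigcupT//; last first.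
    apply/trivIsetP => i j _ _ ij; apply/seteqP;
      split => // q [/Fline[_ qi] /Fline[_ qj]].
    by move: ij; rewrite -qi -qj eqxx.
  apply: (esum_eqy_transfer (h := id) (G := [set: nat]) (c := 2)
    (f := fun k => (\esum_(q in line k) f q)%E)) => //.
  - by move=> k; apply: esum_ge0.
  - by move=> k _; have [] := FP k.
  rewrite -esum_bigcupT//.
    rewrite (_ : \bigcup_(k in _) line k = [set q | q != 0])//.
    apply/seteqP; split => [q [k _ []]//|q q0].
    by exists (line_code q).
  apply/trivIsetP => i j _ _ ij; apply/seteqP; split => // q [[_ qi] [_ qj]].
  by move: ij; rewrite -qi -qj eqxx.
pose h q : 'rV[int]_1 := const_mx ((N (line_code q))%:Z * row_mult q).
(* If h q = h q' with N < N', the prime N' would divide N * gcd(q), although both factors are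
   positive and smaller: gcd(q) <= D < N. *)
have hlt q q' : G q -> G q' -> (line_code q < line_code q')%N -> h q <> h q'.
  move=> Gq Gq' qq' /rowP/(_ ord0); rewrite !mxE => /(congr1 absz).
  rewrite !(abszM (N _)%:Z) !absz_nat !abs_row_mult => E.
  have : (N (line_code q') %| N (line_code q) * gcd_row q)%N by rewrite E
    dvdn_mulr.
  have le_gcd : (gcd_row q <= D (line_code q))%N by apply: DP; exact: GF.
  have lN := incN _ _ qq'.
  rewrite Euclid_dvdM// => /orP[] /dvdn_leq =>
    [/(_ (prime_gt0 (pN _)))|/(_ (gcd_row_gt0 (G0 _ Gq)))].
    by rewrite leqNgt lN.
  by have := DN (line_code q); lia.
have hinj : set_inj G h.
  move=> q q' /set_mem Gq /set_mem Gq' hqq'.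
  case: (ltngtP (line_code q) (line_code q')) => [lt|lt|eq].
  - by case: (hlt _ _ Gq Gq' lt).
  - by case: (hlt _ _ Gq' Gq lt).
  move: hqq' => /rowP/(_ ord0); rewrite !mxE eq.
  have N0 : (N (line_code q'))%:Z != 0 by have :=
    prime_gt0 (pN (line_code q')); lia.
  move=> /(mulfI N0) qq'; rewrite -(row_multK q) -(row_multK q') qq'.
  by rewrite -!gen_line_code eq.
(* The function psi carried over by h and extended by 0 off the image. *)
pose Psi e : R := if pselect (exists2 q, G q & h q = e) is left H
  then psi (projT1 (cid2 H)) else 0.
have PsiP e : (exists2 q, G q /\ h q = e & Psi e = psi q) \/ Psi e = 0.
  rewrite /Psi; case: pselect => [H|]; last by right.
  by left; case: (cid2 H) => q Gq hq /=; exists q.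
have Psi0 e : 0 <= Psi e by case: (PsiP e) => [[q _ ->]|->].
have Psih q : G q -> Psi (h q) = psi q.
  move=> Gq; rewrite /Psi; case: pselect => [H|[]]; last by exists q.
  case: (cid2 H) => q' Gq' /= hq'; congr psi.
  by apply: hinj; rewrite ?inE.
have full : mxprob (L1 Psi) = 1%E.
  apply: full_L1 => //.
  apply: (esum_eqy_transfer (h := h) (G := G) (f := f) (c := 2 ^+ m)) => //.
  - move=> q /G0 q0 /=; rewrite /h const_row1_eq0 mulf_neq0 ?row_mult_eq0//.
    by have := prime_gt0 (pN (line_code q)); lia.
  - by move=> e; rewrite lee_fin weight_ge0.
  - move=> q Gq; rewrite -EFinM lee_fin; apply: weight_dilate_le => //.
    + exact: G0.
    + by apply: leq_ltn_trans (DN _); apply: DP; exact: GF.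
    + exact: Psih.
(* A solution e = h q at z, with q in G on line k, places N_k z in [V k]. *)
pose U k := [set z : 'rV[R]_m | V k (act (const_mx (N k)%:Z : 'rV_1) z)].
have mU k : mxmeasurable (U k) by exact: mxmeasurable_act.
have UV k : mxprob (U k) = mxprob (V k).
  apply: mxprob_act => //; rewrite const_row1_eq0.
  by have := prime_gt0 (pN k); lia.
have : cube_prob R (1 * m)
    (lim_sup_set (fun k => @mx_of_tuple R 1 m @^-1` U k)) = 0%E.
  apply: lim_sup_set_cvg0 => //.
  by apply: le_lt_trans Vfin; rewrite le_eqVlt; apply/orP; left; apply/eqP;
    apply: eq_eseriesr => k _; exact: UV.
apply/eqP; rewrite gt_eqF// (@lt_le_trans _ _ (mxprob (L1 Psi)))//;
  first by rewrite full.
apply: le_measure; rewrite ?inE; first exact: mL1.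
  by apply: bigcap_measurable => // k _; apply: bigcup_measurable => j _;
    exact: mU.
(* Outside the limsup only lines numbered below some K contribute, each through its finite [F k], so
   only finitely many e occur. *)
move=> t Lt K _; apply: contrapT => H; apply: Lt.
apply: (@sub_finite_set _ _ (h @` \bigcup_(k in `I_K) F k)); last first.
  apply: finite_image; apply: bigcup_finite => // k _; exact: finF.
move=> e /= te; case: (PsiP e) => [[q [Gq hq] Pq]|P0]; last first.
  by move: te; rewrite P0 => /targetP[? []]; rewrite ltxx.
exists q => //; exists (line_code q); last exact: GF.
rewrite /= ltnNge; apply/negP => Kq; apply: H; exists (line_code q) => //=.
exists q; split; first exact/Fline/GF.
rewrite -act_scale (_ : _ *: _ = e) -?Pq//.
by apply/rowP => i; rewrite -hq !mxE mulrC.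
Qed.

End reduction.

Theorem theorem2p7 (R : realType) (m : nat) (hm : (0 < m)%N) (y : 'rV[R]_m) :
  WIDSC 1 y -> forall n : nat, (0 < n)%N -> WIDSC n y.
Proof.
move=> W1 n _ psi psi0 psi_oo; rewrite leb_torus_Wset.
(* Either one line already carries a divergent sum, or all lines have finite sums and divergence
   passes to the measures of the V_p. *)
have [[k kfin]|lines] := pselect (exists k,
    (\esum_(q in [set q | q != 0%R /\ pickle (prim_row q) = k])
      (weight m psi q)%:E = +oo)%E); first exact: (full_of_divergent_line psi0 W1 kfin).
apply: full_of_divergent_measures.
apply: divergent_measures => // k; rewrite ltey; apply/eqP => koo.
by apply: lines; exists k.
Qed.
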